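(* Let $G_I$ be the connected and simply connected Lie group whose Lie algebra $\mathfrak{g}_I$ has a basis $\{x,y,z\}$ with $[x,y]=0$, $[z,x]=x$, $[z,y]=y$. Then any left invariant Lorentzian metric on $G_I$ is equivalent up to automorphism to a metric whose associated matrix (with respect to $\{x,y,z\}$) is of the form $$ \begin{bmatrix} 1 & 0 & 0 \\ 0 & -1 & 0 \\ 0 & 0 & \mu \end{bmatrix}\quad\text{or}\quad \begin{bmatrix} 1 & 0 & 0 \\ 0 & 1 & 0 \\ 0 & 0 & -\mu \end{bmatrix}\quad\text{or}\quad \begin{bmatrix} 1 & 0 & 0 \\ 0 & 0 & 1 \\ 0 & 1 & 0 \end{bmatrix}, $$ where $\mu>0$.
   Context: A left invariant Lorentzian metric $h$ on a connected three-dimensional Lie group $G$ is identified with a nondegenerate symmetric bilinear form of signature $(+,+,-)$ on its Lie algebra $\mathfrak{g}$. With respect to a fixed basis of $\mathfrak{g}$, its associated matrix $[h]$ is the symmetric matrix with $h(u,v)=[u]^t[h][v]$, where $[u]$ is the coordinate column vector of $u$. Two left invariant Lorentzian metrics $h,h'$ on $G$ are equivalent up to automorphism if there is a Lie algebra automorphism $\varphi\in\mathrm{Aut}(\mathfrak{g})$ with $[h']=[\varphi]^t[h][\varphi]$. *)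

(* Defs.v *)
From HB Require Import structures.
From mathcomp Require Import all_boot all_order all_algebra.
From mathcomp Require Import reals.

Set Implicit Arguments.
Unset Strict Implicit.
Unset Printing Implicit Defensive.

Import Order.TTheory GRing.Theory Num.Theory.
Local Open Scope ring_scope.

Section LieAlgebra.
Variables (R : realType) (g : vectType R) (br : {bilinear g -> g -> g}).

Definition is_lie_bracket : Prop :=
  (forall u, br u u = 0) /\
  (forall u v w, br u (br v w) + br v (br w u) + br w (br u v) = 0).

Definition is_lie_automorphism (phi : 'End(g)) : Prop :=
  lker phi = 0%VS /\ (forall u v, phi (br u v) = br (phi u) (phi v)).

End LieAlgebra.

Section Matrices.
Variables (R : realType) (g : vectType R) (n : nat) (e : n.-tuple g).

Definition col_coord (u : g) : 'cV[R]_n := \col_i coord e i u.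

Definition endo_mx (phi : 'End(g)) : 'M[R]_n :=
  \matrix_(i, j) coord e i (phi e`_j).

Definition form_mx (h : {symmetric g}) : 'M[R]_n :=
  \matrix_(i, j) h e`_i e`_j.

Lemma endo_mxE (phi : 'End(g)) (u : g) :
  basis_of fullv e -> col_coord (phi u) = endo_mx phi *m col_coord u.
Proof.
move=> eb; apply/colP=> i; rewrite !mxE {1}(coord_basis eb (memvf u)).
rewrite !linear_sum /=; apply: eq_bigr => j _.
by rewrite !linearZ /= !mxE mulrC.
Qed.

Lemma form_mxE (h : {symmetric g}) (u v : g) : basis_of fullv e ->
  h u v = ((col_coord u)^T *m form_mx h *m col_coord v) 0 0.
Proof.
move=> eb; rewrite {1}(coord_basis eb (memvf u)) {1}(coord_basis eb (memvf v)).
rewrite linear_sumr /= mxE; apply: eq_bigr => j _.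
rewrite linearZr_LR linear_sumlz /= mulrC !mxE; congr (_ * _).
by apply: eq_bigr => i _; rewrite linearZl_LR !mxE.
Qed.

End Matrices.

Section LorentzianForms.
Variables (R : realType) (g : vectType R).

(* Some orthogonal basis has [p] vectors with positive square and [q] vectors
   with negative square (by Sylvester's law, every orthogonal basis has). *)
Definition has_signature (h : {symmetric g}) (p q : nat) : Prop :=
  exists b : seq g,
    [/\ basis_of fullv b, pairwise_orthogonal h b,
        count (fun v => 0 < h v v) b = p & count (fun v => h v v < 0) b = q].

(* A left invariant metric on a Lie group is identified with the bilinear form
   it induces on the Lie algebra. *)
Definition lorentzian3 (h : {symmetric g}) : Prop :=
  nondegenerate h /\ has_signature h 2 1.

Definition equiv_up_to_aut (br : {bilinear g -> g -> g}) (n : nat)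
    (e : n.-tuple g) (h h' : {symmetric g}) : Prop :=
  exists2 phi : 'End(g), is_lie_automorphism br phi &
    form_mx e h' = (endo_mx e phi)^T *m form_mx e h *m endo_mx e phi.

End LorentzianForms.

Definition mx3_of_rows (R : realType) (rows : seq (seq R)) : 'M[R]_3 :=
  \matrix_(i, j) (nth [::] rows i)`_j.

(* Main.v *)
Require Import Defs.
From HB Require Import structures.
From mathcomp Require Import all_boot all_order all_algebra.
From mathcomp Require Import reals.
From mathcomp Require Import ring lra zify.

(** If [l] denotes the [z]-coordinate and [W] the plane spanned by [x] and [y],
    the bracket is [[u, v] = l(u) v - l(v) u], so every linear bijection
    preserving [l] is an automorphism: a frame [(u, v, w)] with [(u, v)] a basis
    of [W] and [w] in [z + W] is the image of [(x, y, z)] under an automorphism,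
    and it suffices to choose such a frame in which [h] has the required matrix.
    As [h] has signature [(2, 1)] in dimension 3, every plane contains a vector
    of positive square. Hence [W] has a basis [(u, v)] with [h u u = 1] and
    [h u v = 0]. If [h v v] is nonzero, normalize it to [1] or [-1] and take
    [w] orthogonal to [W]; the sign of [h w w] is forced by the signature. If
    [h v v = 0], then [h v z] is nonzero by nondegeneracy, can be normalized to
    [1], and [w] can be corrected by a multiple of [v] to be isotropic. *)

Set Implicit Arguments.
Unset Strict Implicit.
Unset Printing Implicit Defensive.

Import Order.TTheory GRing.Theory Num.Theory.
Local Open Scope ring_scope.

(** * Symmetric forms: pullback along an endomorphism, and consequences of the signature *)

Section SymmetricForms.
Context {R : realType} {g : vectType R}.
Implicit Types (h : {symmetric g}) (phi : 'End(g)) (u v w : g) (W : {vspace g}).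

Lemma symC h u v : h u v = h v u.
Proof. by rewrite (hermC h) expr0 mul1r. Qed.

Definition pullback phi h u v : R := h (phi u) (phi v).

Lemma pullback_bilinear phi h :
  bilinear_for (GRing.Scale.Law.clone _ _ *%R _)
    (GRing.Scale.Law.clone _ _ *%R _) (pullback phi h).
Proof.
by split=> [u'|u] a v w; rewrite /pullback linearP ?linearPl ?linearPr.
Qed.

HB.instance Definition _ phi h :=
  bilinear_isBilinear.Build R g g R _ _ (pullback phi h)
    (pullback_bilinear phi h).

Lemma pullback_sym phi h u v :
  pullback phi h u v = (-1) ^+ false * idfun (pullback phi h v u).
Proof. by rewrite expr0 mul1r; apply: symC. Qed.

HB.instance Definition _ phi h :=
  isHermitianSesquilinear.Build R g false idfun (pullback phi h)
    (pullback_sym phi h).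

Definition pullback_form phi h : {symmetric g} := pullback phi h.

(** The columns of [endo_mx e phi] are the coordinates of the images of the basis, so congruence by
    this matrix amounts to pulling the form back along [phi]. *)
Lemma form_mx_pullback (n : nat) (e : n.-tuple g) phi h : basis_of fullv e ->
  form_mx e (pullback_form phi h) =
    (endo_mx e phi)^T *m form_mx e h *m endo_mx e phi.
Proof.
move=> eb; apply/matrixP=> i j.
have coordE (k : 'I_n) : col_coord e (phi e`_k) = col k (endo_mx e phi).
  by apply/colP=> l; rewrite !mxE.
rewrite mxE /= /pullback (form_mxE h _ _ eb) !coordE tr_col -!row_mul.
by rewrite colE mulmxA -colE !mxE.
Qed.

(** The preimage under [phi] of an [h]-orthogonal basis is orthogonal for the pullback, with the
    same squares. *)
Lemma pullback_has_signature phi h p q : lker phi = 0%VS ->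
  has_signature h p q -> has_signature (pullback_form phi h) p q.
Proof.
move=> k0 [b [bb ob pb qb]].
have kb : lker phi == 0%VS by rewrite k0.
have k'b : lker phi^-1%VF == 0%VS.
  by apply/lker0P/(can_inj (lker0_lfunVK kb)).
have pullE u v : pullback_form phi h (phi^-1%VF u) (phi^-1%VF v) = h u v.
  by rewrite /= /pullback !lker0_lfunVK.
exists [seq phi^-1%VF v | v <- b]; split.
- by rewrite -(lker0_limgf k'b) limg_basis_of // (eqP k'b) capv0.
- case/andP: ob => nz ob; apply/andP; split.
    rewrite -(linear0 phi^-1%VF) mem_map //; exact/lker0P.
  elim: b ob {bb pb qb nz} => //= v b IHb /andP[/andP[ov _] ob].
  rewrite {}IHb // !andbT; apply/allP => _ /mapP[w wb ->] /=.
  by rewrite pullE; apply: (allP ov).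
- by rewrite count_map -pb; apply: eq_count => v /=; rewrite pullE.
- by rewrite count_map -qb; apply: eq_count => v /=; rewrite pullE.
Qed.

Lemma pullback_nondegenerate phi h : lker phi = 0%VS ->
  nondegenerate h -> nondegenerate (pullback_form phi h).
Proof.
move=> k0 /eqP hn; have kb : lker phi == 0%VS by rewrite k0.
rewrite /nondegenerate -subv0; apply/subvP => u /mem_orthovP uP.
suff: phi u \in orthov h fullv.
  by rewrite hn !memv0 -{1}(linear0 phi) (inj_eq (lker0P kb)).
apply/mem_orthovP => v _; rewrite -[v](lker0_lfunVK kb).
exact: (uP _ (memvf _)).
Qed.

(** By induction on [b]: a vector [k *: a + w], with [w] in the span of the later positive vectors,
    has square [k ^+ 2 * h a a + h w w], and [k] and [w] are not both zero. *)
Lemma orthogonal_span_gt0 h (b : seq g) v : pairwise_orthogonal h b ->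
  v \in <<[seq w <- b | (0 < h w w)%R]>>%VS -> v != 0 -> 0 < h v v.
Proof.
case/andP=> _; elim: b v => [|a b IHb] v /=.
  by rewrite span_nil memv0 => _ ->.
move=> /andP[/andP[oab _] ob]; case: ifP => [a_gt0|_]; last exact: IHb.
rewrite span_cons => /memv_addP[_ /vlineP[k ->] [w wb ->]] vn0.
have oaw : h a w = 0.
  have : (<<[:: a]>> <= orthov h <<[seq c <- b | (0 < h c c)%R]>>)%VS.
    rewrite -orthogonalE /orthogonal /= andbT.
    by apply/allP => c; rewrite mem_filter => /andP[_ /(allP oab)].
  by move/orthovP; apply => //; apply: memv_span1.
rewrite hnormDd; last by rewrite linearZl_LR /= oaw mulr0.
rewrite linearZl_LR linearZr_LR /= mulrA -expr2.
have [w0|wn0] := eqVneq w 0; last first.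
  by apply: ltr_wpDl; [rewrite mulr_ge0 ?sqr_ge0 ?ltW | apply: IHb].
rewrite w0 linear0r addr0 pmulr_lgt0 // exprn_even_gt0 //=.
by apply: contraNneq vn0 => ->; rewrite w0 scale0r addr0.
Qed.

(** The positive vectors of an orthogonal basis span a space of dimension [p] on which [h] is
    positive definite; by the dimension bound it meets [W] nontrivially. *)
Lemma has_signature_gt0 h p q W : has_signature h p q ->
  (\dim {:g} < p + \dim W)%N -> exists2 w, w \in W & 0 < h w w.
Proof.
move=> [b [bb ob pb _]] dimW; set s := [seq w <- b | 0 < h w w].
have ds : \dim <<s>> = p.
  have /eqP := filter_free (fun w => 0 < h w w) (basis_free bb).
  by rewrite size_filter pb.
have [I0|I0] := eqVneq (<<s>> :&: W)%VS 0%VS.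
  have := dimv_sum_cap <<s>> W; rewrite I0 dimv0 ds.
  by have := dimvS (subvf (<<s>> + W)%VS); lia.
have := memv_pick (<<s>> :&: W)%VS; move: I0; rewrite -vpick0; set w := vpick _.
move=> wn0; rewrite memv_cap => /andP[ws wW].
by exists w => //; exact: orthogonal_span_gt0 ob ws wn0.
Qed.

Lemma has_signature_lt0 h p q : has_signature h p q -> (0 < q)%N ->
  exists w, h w w < 0.
Proof.
by move=> [b [_ _ _ <-]]; rewrite -has_count => /hasP[w _ wn]; exists w.
Qed.

Lemma hnorm_orthogonal3 h u v w a b c : h u v = 0 -> h u w = 0 -> h v w = 0 ->
  h (a *: u + (b *: v + c *: w)) (a *: u + (b *: v + c *: w)) =
    a ^+ 2 * h u u + (b ^+ 2 * h v v + c ^+ 2 * h w w).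
Proof.
move=> uv uw vw; rewrite hnormDd; last first.
  by rewrite linearDr !linearZr_LR !linearZl_LR /= uv uw !mulr0 addr0.
rewrite hnormDd; last by rewrite linearZr_LR linearZl_LR /= vw !mulr0.
by rewrite !linearZr_LR !linearZl_LR /= !mulrA -!expr2.
Qed.

End SymmetricForms.

(** * The Lie algebra, its bracket formula, and automorphisms from adapted frames *)

Section RankOneBracket.
Context {R : realType} {g : vectType R} (br : {bilinear g -> g -> g}).
Context (x y z : g).
Hypothesis brL : is_lie_bracket br.
Hypothesis xyz_basis : basis_of fullv [:: x; y; z].
Hypotheses (brxy : br x y = 0) (brzx : br z x = x) (brzy : br z y = y).

Local Notation e := [tuple x; y; z].
Local Notation W := <<[:: x; y]>>%VS.
Local Notation l := (coord e ord_max).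
Implicit Types (u v w : g).

Lemma dim_xyz : \dim {:g} = 3.
Proof. exact: (size_basis (X := e)). Qed.

Lemma plane_xy : [/\ \dim W = 2, z \notin W & (<<[:: z]>> + W)%VS = fullv].
Proof.
have zb : basis_of fullv [:: z; x; y].
  by rewrite (@perm_basis _ _ _ [:: x; y; z]) // (perm_catC [:: z] [:: x; y]).
have := basis_free zb; rewrite free_cons => /andP[zW /eqnP fW].
by split=> //; rewrite span_seq1 -span_cons; apply: span_basis.
Qed.

Lemma coordz_z : l z = 1.
Proof. exact: (coord_free (X := e) ord_max ord_max (basis_free xyz_basis)). Qed.

Lemma coordz_plane u : u \in W -> l u = 0.
Proof.
have fe := basis_free xyz_basis.
rewrite span_cons span_seq1 => /memv_addP[_ /vlineP[a ->] [_ /vlineP[b ->] ->]].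
have lx : l x = 0 := coord_free (X := e) ord0 ord_max fe.
have ly : l y = 0 := coord_free (X := e) (lift ord0 ord0) ord_max fe.
by rewrite linearD !linearZ /= lx ly !mulr0 addr0.
Qed.

(** Write [u = l u *: z + s] and [v = l v *: z + t] with [s], [t] in [W]. As [W] is abelian and [z]
    acts on it as the identity, both sides equal [l u *: t - l v *: s]. *)
Lemma bracketE u v : br u v = l u *: v - l v *: u.
Proof.
have [_ _ fW] := plane_xy.
have anti s t : br s t = - br t s.
  apply/eqP; rewrite -addr_eq0; have := brL.1 (s + t).
  by rewrite linearDl !linearDr !brL.1 add0r addr0 => ->.
have brzW s : s \in W -> br z s = s.
  rewrite span_cons span_seq1.
  move=> /memv_addP[_ /vlineP[a ->] [_ /vlineP[b ->] ->]].
  by rewrite linearDr !linearZr_LR /= brzx brzy.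
have brW s t : s \in W -> t \in W -> br s t = 0.
  rewrite span_cons span_seq1.
  move=> /memv_addP[_ /vlineP[a ->] [_ /vlineP[b ->] ->]].
  move=> /memv_addP[_ /vlineP[c ->] [_ /vlineP[d ->] ->]].
  rewrite linearDr !linearDl !linearZr_LR !linearZl_LR /= (anti y x) brxy
    !brL.1.
  by rewrite oppr0 !scaler0 !addr0.
have dec s : exists2 t, t \in W & s = l s *: z + t.
  have : s \in (<<[:: z]>> + W)%VS by rewrite fW memvf.
  rewrite span_seq1 => /memv_addP[_ /vlineP[a ->] [t tW ->]]; exists t => //.
  have -> : l (a *: z + t) = a.
    by rewrite linearD linearZ /= coordz_z coordz_plane // mulr1 addr0.
  by [].
have [s sW us] := dec u; have [t tW vt] := dec v.
(* Generalizing the coordinates first keeps the substitution of [u] and [v] out of [l u] and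
   [l v]. *)
move: (l u) (l v) us vt => a b -> ->.
rewrite linearDr !linearDl !linearZr_LR !linearZl_LR /= brL.1.
rewrite (anti s z) !brzW // brW // !scaler0 add0r addr0.
rewrite !scalerDr !scalerA (mulrC b a) scalerN opprD addrACA subrr add0r.
by rewrite addrC.
Qed.

(** If [w] were in the span of [u] and [v], then [z = w - (w - z)] would lie in [W]. *)
Lemma adapted_basis u v w :
  u \in W -> v \in W -> w - z \in W -> u != 0 -> v \notin <[u]>%VS ->
  basis_of fullv [:: u; v; w].
Proof.
have [dW zW _] := plane_xy => uW vW wzW un0 vu.
rewrite basisEfree subvf dim_xyz /= andbT.
rewrite (@perm_free _ _ _ [:: w; v; u]);
  last by rewrite (perm_rev [:: w; v; u]).
rewrite !free_cons nil_free span_seq1 span_nil memv0 vu un0 !andbT.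
apply: contra zW => /(subvP _ _)-/(_ W) wW.
rewrite -[z](subKr w) rpredB // wW //.
by apply/span_subvP => a; rewrite !inE => /orP[]/eqP->.
Qed.

Lemma automorphism_of_adapted u v w :
  u \in W -> v \in W -> w - z \in W -> u != 0 -> v \notin <[u]>%VS ->
  exists2 phi : 'End(g), is_lie_automorphism br phi &
    [/\ phi x = u, phi y = v & phi z = w].
Proof.
move=> uW vW wzW un0 vu; have uvw := adapted_basis uW vW wzW un0 vu.
have [f /(_ (basis_free xyz_basis) erefl) [fx fy fz]] :=
  linear_of_free [:: x; y; z] [:: u; v; w].
exists (linfun f); last by rewrite !lfunE.
have lw : l w = 1.
  by rewrite -[w](subrK z) linearD /= coordz_plane // coordz_z add0r.
have lf t : l (linfun f t) = l t.
  rewrite lfunE [in LHS](coord_basis (X := e) xyz_basis (memvf t)).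
  rewrite !big_ord_recl big_ord0 /= addr0 !linearD !linearZ /= fx fy fz lw.
  rewrite (coordz_plane uW) (coordz_plane vW).
  have -> : lift ord0 (lift ord0 ord0) = ord_max :> 'I_3 by apply: val_inj.
  by rewrite !mulr0 !add0r mulr1.
split; last by move=> s t; rewrite !bracketE !lf linearB !linearZ.
(* The image contains the basis [u], [v], [w], so the map is onto and rank-nullity makes its kernel
   trivial. *)
have := limg_ker_dim (linfun f) fullv; rewrite capfv.
have -> : limg (linfun f) = fullv.
  rewrite -{1}(span_basis xyz_basis) limg_span /= !lfunE /= fx fy fz.
  exact: span_basis uvw.
by rewrite -{2}[\dim fullv]add0n => /addIn/eqP; rewrite dimv_eq0 => /eqP.
Qed.

(** The metric [h'] is the pullback of [h] along the automorphism carrying the basis to the frame,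
    so its matrix is the Gram matrix of the frame. What remains is to choose the frame. *)
Lemma lorentzian_normal_form h u v w : lorentzian3 h ->
  u \in W -> v \in W -> w - z \in W -> u != 0 -> v \notin <[u]>%VS ->
  exists h' : {symmetric g}, [/\ lorentzian3 h', equiv_up_to_aut br e h h'
    & form_mx e h' = mx3_of_rows [:: [:: h u u; h u v; h u w];
                                     [:: h u v; h v v; h v w];
                                     [:: h u w; h v w; h w w]]].
Proof.
move=> [hn hs] uW vW wzW un0 vu.
have [phi phiA [px py pz]] := automorphism_of_adapted uW vW wzW un0 vu.
exists (pullback_form phi h); split.
- by split; [apply: pullback_nondegenerate phiA.1 hn
            | apply: pullback_has_signature phiA.1 hs].
- by exists phi => //; apply: form_mx_pullback.
apply/matrixP => i j; rewrite !mxE /= /pullback.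
case: i => [[|[|[|//]]] ?]; case: j => [[|[|[|//]]] ?] /=;
  by rewrite ?px ?py ?pz // symC.
Qed.

End RankOneBracket.

(** * Choice of the frame, according to the sign of [h v v] *)

Theorem theorem3p8 (R : realType) (g : vectType R)
    (br : {bilinear g -> g -> g}) (x y z : g) :
  is_lie_bracket br ->
  basis_of fullv [:: x; y; z] ->
  br x y = 0 -> br z x = x -> br z y = y ->
  forall h : {symmetric g}, lorentzian3 h ->
  exists h' : {symmetric g},
    [/\ lorentzian3 h',
        equiv_up_to_aut br [tuple x; y; z] h h'
      & [\/ exists2 mu : R, 0 < mu &
              form_mx [tuple x; y; z] h' =
              mx3_of_rows [:: [:: 1;  0; 0];
                              [:: 0; -1; 0];
                              [:: 0;  0; mu]],
            exists2 mu : R, 0 < mu &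
              form_mx [tuple x; y; z] h' =
              mx3_of_rows [:: [:: 1; 0; 0];
                              [:: 0; 1; 0];
                              [:: 0; 0; - mu]]
          | form_mx [tuple x; y; z] h' =
              mx3_of_rows [:: [:: 1; 0; 0];
                              [:: 0; 0; 1];
                              [:: 0; 1; 0]]]].
Proof.
move=> brL xyzb brxy brzx brzy h hL; have [hn hs] := hL.
have [dW zW _] := plane_xy xyzb; set W := <<[:: x; y]>>%VS in dW zW *.
have [u uW huu] : exists2 u, u \in W & h u u = 1.
  have [|u uW u_gt0] := has_signature_gt0 (W := W) hs;
    first by rewrite dW (dim_xyz xyzb).
  have s_gt0 : 0 < Num.sqrt (h u u) by rewrite sqrtr_gt0.
  exists ((Num.sqrt (h u u))^-1 *: u); first by rewrite rpredZ.
  rewrite linearZl_LR linearZr_LR /= -{3}(sqr_sqrtr (ltW u_gt0)).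
  by field; rewrite gt_eqF.
have un0 : u != 0.
  by apply: contra_eq_neq huu => ->; rewrite linear0r eq_sym oner_eq0.
have [v [vW vu huv]] : exists v, [/\ v \in W, v \notin <[u]>%VS & h u v = 0].
  have /subvPn[v vW vu] : ~~ (W <= <[u]>)%VS.
    by apply/negP => /dimvS; rewrite dW dim_vline un0.
  exists (v - h u v *: u); split; first by rewrite !rpredB ?rpredZ.
    apply: contra vu => vu; rewrite -(subrK (h u v *: u) v).
    by rewrite rpredD // rpredZ // memv_line.
  by rewrite linearBr linearZr_LR /= huu mulr1 subrr.
have scaled c : c != 0 -> exists v',
    [/\ v' \in W, v' \notin <[u]>%VS, h u v' = 0,
        h v' v' = c ^+ 2 * h v v & h v' z = c * h v z].
  move=> c0; exists (c *: v); rewrite !rpredZeq negb_or c0 vu vW orbT.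
  by rewrite !linearZl_LR !linearZr_LR /= huv mulr0 mulrA.
(* In every case [w] is [z - h u z *: u - b *: v'], which is in [z + W] and orthogonal to [u] for
   any [b]; only [b] depends on the case. *)
have wW v' a b : v' \in W -> z - a *: u - b *: v' - z \in W.
  by move=> v'W; rewrite addrAC (addrAC z) subrr add0r rpredB ?rpredN ?rpredZ.
have huw v' b : h u v' = 0 -> h u (z - h u z *: u - b *: v') = 0.
  move=> huv'.
  by rewrite !linearBr !linearZr_LR /= huu huv' mulr1 mulr0 subr0 subrr.
have hvw v' b : h u v' = 0 ->
    h v' (z - h u z *: u - b *: v') = h v' z - b * h v' v'.
  move=> huv'.
  by rewrite !linearBr !linearZr_LR /= (symC h v' u) huv' mulr0 subr0.
have [vv_lt0|vv_gt0|vv0] := ltgtP (h v v) 0.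
- have s_gt0 : 0 < Num.sqrt (- h v v) by rewrite sqrtr_gt0 oppr_gt0.
  have [|v' [v'W v'u huv' hvv' _]] := scaled (Num.sqrt (- h v v))^-1.
    by rewrite invr_eq0 gt_eqF.
  have {}hvv' : h v' v' = -1.
    have vvE : h v v = - (Num.sqrt (- h v v)) ^+ 2.
      by rewrite sqr_sqrtr ?opprK // oppr_ge0 ltW.
    by rewrite hvv' [X in _ * X]vvE; field; rewrite gt_eqF.
  (* The coefficient of [v'] is [h v' z / h v' v'], with [h v' v' = -1]. *)
  pose w := z - h u z *: u - (- h v' z) *: v'.
  have uw : h u w = 0 by exact: huw.
  have vw : h v' w = 0 by rewrite hvw // hvv'; ring.
  have wzW := wW v' (h u z) (- h v' z) v'W.
  have := lorentzian_normal_form brL xyzb brxy brzx brzy hL uW v'W wzW un0 v'u.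
  rewrite -/w huu huv' uw vw hvv' => -[h' [h'L hh' h'E]].
  exists h'; split=> //; constructor 1; exists (h w w) => //.
  (* The plane of [v'] and [w] contains a positive vector, whose square is
     [- a ^+ 2 + b ^+ 2 * h w w]; hence [h w w] is positive. *)
  have := basis_free (adapted_basis xyzb uW v'W wzW un0 v'u).
  rewrite free_cons => /andP[_ /eqnP dvw].
  have [|t] := has_signature_gt0 (W := <<[:: v'; w]>>) hs;
    first by rewrite dvw (dim_xyz xyzb).
  rewrite span_cons span_seq1.
  move=> /memv_addP[_ /vlineP[a ->] [_ /vlineP[b ->] ->]].
  have := hnorm_orthogonal3 0 a b huv' uw vw; rewrite scale0r add0r => ->.
  rewrite hvv' ltNge => t_gt0; rewrite ltNge; apply: contra t_gt0 => ww_le0.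
  by nra.
- have s_gt0 : 0 < Num.sqrt (h v v) by rewrite sqrtr_gt0.
  have [|v' [v'W v'u huv' hvv' _]] := scaled (Num.sqrt (h v v))^-1.
    by rewrite invr_eq0 gt_eqF.
  have {}hvv' : h v' v' = 1.
    have vvE : h v v = (Num.sqrt (h v v)) ^+ 2 by rewrite sqr_sqrtr // ltW.
    by rewrite hvv' [X in _ * X]vvE; field; rewrite gt_eqF.
  pose w := z - h u z *: u - h v' z *: v'.
  have uw : h u w = 0 by exact: huw.
  have vw : h v' w = 0 by rewrite hvw // hvv'; ring.
  have wzW := wW v' (h u z) (h v' z) v'W.
  have := lorentzian_normal_form brL xyzb brxy brzx brzy hL uW v'W wzW un0 v'u.
  rewrite -/w huu huv' uw vw hvv' => -[h' [h'L hh' h'E]].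
  exists h'; split=> //; constructor 2; exists (- h w w); last by rewrite opprK.
  (* Were [h w w] nonnegative, every square would be a sum of nonnegative terms, yet some vector has
     negative square. *)
  have [t] := has_signature_lt0 hs isT.
  have uvw := adapted_basis xyzb uW v'W wzW un0 v'u.
  rewrite (coord_basis (X := [tuple u; v'; w]) uvw (memvf t)) !big_ord_recl
    big_ord0 /= addr0.
  rewrite hnorm_orthogonal3 // huu hvv' !mulr1 oppr_gt0 ltNge => t_lt0.
  rewrite ltNge; apply: contra t_lt0 => ww_ge0.
  by rewrite !addr_ge0 ?sqr_ge0 // mulr_ge0 ?sqr_ge0.
(* Otherwise [v] would be orthogonal to the basis [u], [v], [z], hence zero, although it is not in
   [<[u]>]. *)
have vz0 : h v z != 0.
  apply/eqP => vz0; case/negP: (vu); suff -> : v = 0 by rewrite mem0v.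
  apply/eqP; rewrite -memv0 -(eqP hn); apply/mem_orthovP => t _.
  have uvz : basis_of fullv [:: u; v; z].
    by apply: (adapted_basis xyzb uW vW _ un0 vu); rewrite subrr mem0v.
  rewrite (coord_basis (X := [tuple u; v; z]) uvz (memvf t)) !big_ord_recl
    big_ord0 /= addr0.
  by rewrite !linearDr !linearZr_LR /= (symC h v u) huv vv0 vz0 !mulr0 !addr0.
have [|v' [v'W v'u huv' hvv' hvz]] := scaled (h v z)^-1;
  first by rewrite invr_eq0.
rewrite vv0 mulr0 in hvv'; rewrite mulVf // in hvz.
(* Since [v'] is isotropic and [h v' z = 1], [h w w = h z z - h u z ^+ 2 - 2 * b]; this [b] is its
   root. *)
pose b := (h z z - h u z ^+ 2) / 2.
pose w := z - h u z *: u - b *: v'.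
have uw : h u w = 0 by exact: huw.
have vw : h v' w = 1 by rewrite hvw // hvv' hvz mulr0 subr0.
have ww : h w w = 0.
  rewrite {1}/w !linearBl !linearZl_LR /= uw vw mulr0 subr0 mulr1.
  rewrite !linearBr !linearZr_LR /= (symC h z u) (symC h z v') hvz /b.
  by field.
have wzW := wW v' (h u z) b v'W.
have := lorentzian_normal_form brL xyzb brxy brzx brzy hL uW v'W wzW un0 v'u.
rewrite -/w huu huv' uw vw hvv' ww => -[h' [h'L hh' h'E]].
by exists h'; split=> //; constructor 3.
Qed.
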